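(* Every finitely generated variety with an edge term has at most countably many subvarieties.
   Context: An algebra is an algebraic structure of some fixed type, i.e. a set with operations interpreting a fixed set of finitary operation symbols. A variety is a class of algebras of a fixed type that consists of all algebras of this type satisfying some (possibly infinite) set of identities $s \approx t$, where $s,t$ are terms. For an algebra $\mathbf{A}$, $\mathbb{V}(\mathbf{A})$ denotes the smallest variety containing $\mathbf{A}$, i.e. the class of all algebras of the same type that satisfy all identities satisfied by $\mathbf{A}$. A variety $V$ is finitely generated if $V = \mathbb{V}(\mathbf{A})$ for some finite algebra $\mathbf{A}$. A subvariety of $V$ is a variety (of the same type) contained in $V$. For $k \ge 2$, a function $t : A^{k+1} \to A$ is a $k$-edge operation if for all $x,y \in A$ we have $t(y,y,x,\ldots,x) = t(y,x,y,x,\ldots,x) = x$ and, for all $i \in \{4,\ldots,k+1\}$, $t(x,\ldots,x,y,x,\ldots,x) = x$ with $y$ in position $i$. A variety has an edge term if, for some $k \ge 2$, there is a $(k+1)$-ary term in its language which induces a $k$-edge operation on every algebra in the variety. *)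

(* Defs.v *)
From HB Require Import structures.
From mathcomp Require Import all_boot.
From mathcomp Require Import boolp classical_sets functions cardinality.

Set Implicit Arguments.
Unset Strict Implicit.
Unset Printing Implicit Defensive.

Local Open Scope classical_set_scope.

(* The set of operation symbols is arbitrary: it may be infinite, even
   uncountable. *)
Record signature := Signature {
  symbol : Type;
  arity : symbol -> nat
}.

(* The carrier is not required to be inhabited: it may be empty when there are
   no nullary symbols. The empty algebra then belongs to every variety. *)
Record algebra (S : signature) := Algebra {
  carrier :> Type;
  interp : forall f : symbol S, ('I_(arity f) -> carrier) -> carrier
}.

Inductive term (S : signature) (X : Type) : Type :=
| Var of X
| App (f : symbol S) of ('I_(arity f) -> term S X).

Fixpoint eval (S : signature) (X : Type) (A : algebra S) (t : term S X)
    (v : X -> A) {struct t} : A :=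
  match t with
  | Var x => v x
  | App f ts => interp (fun i => eval (ts i) v)
  end.
Arguments eval {S X} A t v.

(* (s, t) stands for s ≈ t, over the variables x_0, x_1, x_2, ... *)
Definition identity (S : signature) : Type := (term S nat * term S nat)%type.

Definition satisfies (S : signature) (A : algebra S) (e : identity S) : Prop :=
  forall v : nat -> A, eval A e.1 v = eval A e.2 v.

Definition models (S : signature) (E : set (identity S)) : set (algebra S) :=
  [set A | forall e, E e -> satisfies A e].

Definition identities (S : signature) (A : algebra S) : set (identity S) :=
  [set e | satisfies A e].

Definition variety (S : signature) (V : set (algebra S)) : Prop :=
  exists E : set (identity S), V = models E.

Definition variety_of (S : signature) (A : algebra S) : set (algebra S) :=
  models (identities A).

Definition finitely_generated (S : signature) (V : set (algebra S)) : Prop :=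
  exists2 A : algebra S, finite_set [set: A] & V = variety_of A.

Definition subvarieties (S : signature) (V : set (algebra S)) :
    set (set (algebra S)) :=
  [set W | variety W /\ W `<=` V].

(* Positions are numbered from 0: the three clauses say t(y,y,x,...,x) = x,
   t(y,x,y,x,...,x) = x and, for every i in {4,...,k+1} (1-based),
   t(x,...,x,y,x,...,x) = x with y in position i. *)
Definition edge_operation (A : Type) (k : nat) (t : ('I_k.+1 -> A) -> A) :
    Prop :=
  forall x y : A,
    [/\ t (fun j => if (j == 0 :> nat) || (j == 1 :> nat) then y else x) = x,
        t (fun j => if (j == 0 :> nat) || (j == 2 :> nat) then y else x) = x
      & forall i : 'I_k.+1, 3 <= i ->
          t (fun j => if j == i then y else x) = x].

Definition has_edge_term (S : signature) (V : set (algebra S)) : Prop :=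
  exists2 k : nat, 2 <= k &
    exists t : term S 'I_k.+1,
      forall A : algebra S, V A -> edge_operation (eval A t).

(* Main.v *)
Require Import Defs.
From mathcomp Require Import all_boot.
From mathcomp Require Import boolp classical_sets functions cardinality.

Set Implicit Arguments.
Unset Strict Implicit.
Unset Printing Implicit Defensive.

(** Let V be generated by the finite algebra A. A subvariety W of V is known once
    one knows which pairs of term operations of A are equated by W. For each n
    the equated pairs of n-ary operations form a set R n of functions from A^n
    to A x A. This set is closed under the edge operation of A x A, and the
    family R is closed under renaming variables. The point is that such a
    family is determined by its members of arity at most N, for some N
    depending on the family ([determined_by_small_arity]). As A x A is finite,
    N and these members amount to a finite amount of data, so there are only
    countably many families and hence countably many subvarieties.

    To find N, let R' n consist of the functions all of whose renamings into at
    most N variables belong to R. Then R is contained in R', both agree up to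
    arity N, and the task is to choose N so that R' = R. For this the edge
    operation supplies a criterion ([eq_of_forks]). Order the points of A^n
    linearly, and call (p, q) a fork of R n at a point x if two members of R n
    agree at all points before x and take the values p and q at x. If R n is
    contained in R' n, then they are equal as soon as they have the same forks
    at each point and the same restrictions to fewer than k points.

    Fewer than k points of A^n have only boundedly many different columns, so
    that identifying variables with the same column reduces restrictions to
    bounded arity ([small_projections]).

    For forks, regard points as words over A. Suppose that the word b arises
    from a by inserting duplicates, each of them after a copy of the same letter
    that belongs to a ([folds]). Then identifying variables turns forks at b
    into forks at a ([fork_folds]), provided that points are ordered
    lexicographically ([folds_substitution]). By Higman's lemma this
    relation between words is a well-quasi-order, even after colouring words by
    their fork sets ([folds_good]). So every word b has such an a of bounded
    length with the same R-forks ([folds_basis]); if N exceeds this bound, then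
    the R'-forks at b are R'-forks at a, which are R-forks at a because R and R'
    agree in small arity, and these are the R-forks at b. *)

(** * Higman's lemma *)

Lemma pigeonhole (C : finType) (c : nat -> C) :
  exists x, exists2 sigma : nat -> nat,
    {homo sigma : i j / i < j} & forall i, c (sigma i) = x.
Proof.
have [x inf_x] : exists x, forall n, exists2 m, n <= m & c m = x.
  apply: contrapT => nofreq.
  have /choice[bound boundP] : forall x, exists n, forall m, n <= m -> c m <> x.
    move=> x; apply: contrapT => nbound; apply: nofreq; exists x => n.
    apply: contrapT => nm; apply: nbound; exists n => m le_nm cm.
    by apply: nm; exists m.
  pose n := \max_x bound x.
  by apply: (boundP (c n) n) => //; exact: (leq_bigmax (F := bound)).
have [next le_next c_next] : exists2 next : nat -> nat,
    forall n, n <= next n & forall n, c (next n) = x.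
  have /choice[next nextP] : forall n, exists m, n <= m /\ c m = x.
    by move=> n; have [m] := inf_x n; exists m.
  by exists next => n; have [] := nextP n.
exists x, (fun i => iter i (next \o succn) (next 0)).
  apply: homo_ltn => [i j k|i]; first exact: ltn_trans.
  by rewrite iterS; apply: le_next.
by case=> [|i] /=.
Qed.

Definition bad (X : eqType) (f : nat -> seq X) :=
  forall i j, i < j -> ~~ subseq (f i) (f j).

(** Nash-Williams' device: the entries are minimised one after the other, and the
    diagonal of the successive improvements is bad because each initial segment
    of it is an initial segment of a bad sequence. *)
Lemma minimal_bad_sequence (X : eqType) (f : nat -> seq X) : bad f ->
  exists2 g : nat -> seq X, bad g & forall n h, bad h -> (forall i, i < n -> h i = g i) ->
    size (g n) <= size (h n).
Proof.
move=> bad_f.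
(* A bad sequence can be changed from place n on so that it stays bad and its
   entry at place n is as short as possible. *)
have /choice[step stepP] : forall (nf : nat * (nat -> seq X)), exists g : nat -> seq X,
    bad nf.2 -> [/\ bad g, forall i, i < nf.1 -> g i = nf.2 i &
      forall h : nat -> seq X, bad h -> (forall i, i < nf.1 -> h i = nf.2 i) ->
        size (g nf.1) <= size (h nf.1)].
  case=> n {bad_f}f /=; have [bad_f|nbad] := pselect (bad f); last by exists f.
  pose P l := `[< exists2 g : nat -> seq X, bad g /\ (forall i, i < n -> g i = f i) &
                  size (g n) = l >].
  have exP : exists l, P l by exists (size (f n)); apply/asboolP; exists f.
  have [l /asboolP[g [bad_g gf] <-] lmin] := ex_minnP exP.
  exists g => _; split=> // h bad_h hf; apply: lmin; apply/asboolP.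
  by exists h.
pose F := fix F n := step (n, if n is m.+1 then F m else f).
have badF n : bad (F n).
  by elim: n => [|n IHn] /=; [have [] := stepP (0, f) bad_f
                             |have [] := stepP (n.+1, F n) IHn].
have FS n i : i <= n -> F n.+1 i = F n i.
  by have [_ + _] := stepP (n.+1, F n) (badF n); apply.
have Fstable i n : i <= n -> F n i = F i i.
  elim: n => [|n IHn]; first by rewrite leqn0 => /eqP->.
  by rewrite leq_eqVlt => /predU1P[->//|lt_in]; rewrite FS // IHn.
exists (fun n => F n n) => [i j lt_ij|n h bad_h hF].
  by rewrite -(Fstable i j (ltnW lt_ij)); apply: badF.
case: n hF => [|n] hF; first by have [_ _ ->] := stepP (0, f) bad_f.
have [_ _ ->//] := stepP (n.+1, F n) (badF n).
by move=> i lt_in /=; rewrite hF // (Fstable i n).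
Qed.

(** In a minimal bad sequence infinitely many entries start with the same
    letter. Cutting it off from all of these, and dropping the other entries
    from the first of these on, gives a bad sequence that is smaller. *)
Lemma higman (X : finType) (f : nat -> seq X) :
  exists i j, i < j /\ subseq (f i) (f j).
Proof.
apply: contrapT => nogood.
have /minimal_bad_sequence[{nogood}g bad_g gmin] : bad f.
  by move=> i j lt_ij; apply/negP => sub_ij; apply: nogood; exists i, j.
have g_cons n : exists p, g n = p.1 :: p.2.
  have := bad_g n n.+1 (ltnSn n).
  by case: (g n) => [|x w]; [rewrite sub0seq|exists (x, w)].
have [ht ghtE] := choice g_cons.
have [x [sigma mono_sigma headE]] := pigeonhole (fun n => (ht n).1).
have gE i : g (sigma i) = x :: (ht (sigma i)).2 by rewrite ghtE headE.
pose n := sigma 0.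
pose h i := if i < n then g i else (ht (sigma (i - n))).2.
have sigma_ge i : n <= sigma i.
  by case: i => // i; apply/ltnW/mono_sigma.
have bad_h : bad h.
  move=> i j lt_ij; rewrite /h; case: (ltnP j n) => [lt_jn|le_nj].
    by rewrite (ltn_trans lt_ij lt_jn); apply: bad_g.
  case: (ltnP i n) => [lt_in|le_ni].
    apply: contra (bad_g _ _ (leq_trans lt_in (sigma_ge (j - n)))) => sub_ij.
    by rewrite gE (subseq_trans sub_ij) ?subseq_cons.
  have lt_ij' : i - n < j - n by rewrite ltn_sub2r // (leq_ltn_trans le_ni).
  have := bad_g _ _ (mono_sigma _ _ lt_ij').
  by rewrite !gE /= eqxx.
have := gmin n h bad_h; rewrite {2}/h ltnn subnn gE /= => min_n.
have : (size (ht (sigma 0)).2).+1 <= size (ht (sigma 0)).2.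
  by apply: min_n => i lt_in; rewrite /h lt_in.
by rewrite ltnn.
Qed.

(** * Words with identified letters *)

(** A letter of b may be deleted if a copy of it further right is kept; a is what
    remains. Words are read from right to left, so that cons adds the letter that
    comes last, and deletable letters are duplicates of earlier ones. *)
Inductive folds (X : eqType) : seq X -> seq X -> Prop :=
| FoldsNil : folds [::] [::]
| FoldsKeep x a b : folds a b -> folds (x :: a) (x :: b)
| FoldsDrop x a b : folds a b -> x \in a -> folds a (x :: b).

(** Marking the occurrences of a letter that are new, reading from the right, forces
    a marked subword with the same set of letters to keep all first occurrences.
    This reduces [folds] to the subword order of Higman's lemma. *)
Fixpoint mark_new (X : eqType) (w : seq X) : seq (X * bool) :=
  if w is x :: w' then (x, x \notin w') :: mark_new w' else [::].

Lemma map_mark_new (X : eqType) (w : seq X) : map fst (mark_new w) = w.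
Proof. by elim: w => //= x w ->. Qed.

Lemma folds_of_subseq (X : eqType) (a b : seq X) :
  a =i b -> subseq (mark_new a) (mark_new b) -> folds a b.
Proof.
elim: b a => [|y b IHb] a eq_ab.
  by case: a eq_ab => [_ _|x a eq_ab _]; [constructor|have := eq_ab x; rewrite inE eqxx].
case: a eq_ab => [eq_ab _|x a eq_ab]; first by have := eq_ab y; rewrite inE eqxx.
rewrite [mark_new (x :: a)]/= [mark_new (y :: b)]/= [subseq _ _]/=.
case: eqP => [[eq_xy new_xy] sub_ab|neq_xy sub_ab].
  subst y; apply: FoldsKeep; apply: (IHb _ _ sub_ab) => z.
  have := eq_ab z; rewrite !inE; case: eqP => //= -> _.
  by apply: negb_inj; rewrite new_xy.
(* The last letter y of b is dropped. It cannot be new: all letters of a occur in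
   the rest of b, and y is one of them. *)
have sub_letters : {subset x :: a <= b}.
  move=> z az; rewrite -(map_mark_new b).
  by rewrite (mem_subseq (map_subseq fst sub_ab)) //= map_mark_new.
have y_xa : y \in x :: a by rewrite eq_ab mem_head.
apply: FoldsDrop (y_xa); apply: (IHb (x :: a) _ sub_ab) => z. rewrite eq_ab inE.
by case: eqP => // ->; rewrite (sub_letters _ y_xa).
Qed.

Lemma folds_good (X C : finType) (c : seq X -> C) (w : nat -> seq X) :
  exists i j, [/\ i < j, folds (w i) (w j) & c (w i) = c (w j)].
Proof.
have [x [sigma mono_sigma sigmaP]] :=
  pigeonhole (fun n => ([set x in w n], c (w n))).
have [i [j [lt_ij sub_ij]]] := higman (fun n => mark_new (w (sigma n))).
have: ([set x in w (sigma i)], c (w (sigma i))) =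
      ([set x in w (sigma j)], c (w (sigma j))) by rewrite !sigmaP.
case=> /setP eq_letters eq_c.
exists (sigma i), (sigma j); split=> //; first exact: mono_sigma.
by apply: folds_of_subseq sub_ij => z; have := eq_letters z; rewrite !inE.
Qed.

(** Otherwise choose for each N a word b N without such an a of size at most N. Along
    a sequence of values of N that exceed the sizes of the earlier words, these
    words contradict [folds_good]. *)
Lemma folds_basis (X C : finType) (c : seq X -> C) :
  exists N, forall b, exists a, [/\ size a <= N, folds a b & c a = c b].
Proof.
apply: contrapT => nobasis.
have /choice[b bP] : forall N, exists b,
    forall a, size a <= N -> folds a b -> c a <> c b.
  move=> N; apply: contrapT => nob; apply: nobasis; exists N => b.
  apply: contrapT => noa; apply: nob; exists b => a le_aN fold_ab eq_c.
  by apply: noa; exists a.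
pose N i := iter i (fun n => maxn n (size (b n))) 0.
have mono_N : {homo N : i j / i <= j}.
  apply: homo_leq => [//|i j k|i]; first exact: leq_trans.
  by rewrite /N iterS leq_maxl.
have [i [j [lt_ij fold_ij eq_c]]] := folds_good c (fun i => b (N i)).
apply: bP fold_ij eq_c; apply: leq_trans (mono_N _ _ lt_ij).
by rewrite /N iterS leq_maxr.
Qed.

(** Base-#|X| numerals with the last letter in reading order, which is the head, as
    least significant digit. On words of equal length, comparing numerals is the
    lexicographic order. *)
Definition numeral (X : finType) (w : seq X) : nat :=
  foldr (fun x v => v * #|X| + enum_rank x) 0 w.

Lemma numeral_lt (X : finType) (x y : X) (v w : seq X) :
  (numeral (x :: v) < numeral (y :: w)) =
  (numeral v < numeral w) ||
  (numeral v == numeral w) && (enum_rank x < enum_rank y).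
Proof.
rewrite /=; have := ltn_ord (enum_rank x); have := ltn_ord (enum_rank y).
move: (nat_of_ord _) (nat_of_ord _) => i j; set q := #|X| => lt_i lt_j.
have lt_digits m n k l : m < n -> k < q -> m * q + k < n * q + l.
  move=> lt_mn lt_kq; apply: (@leq_trans (m.+1 * q)).
    by rewrite mulSn addnC ltn_add2r.
  by rewrite (leq_trans (leq_mul lt_mn (leqnn q))) ?leq_addr.
case: (ltngtP (numeral v) (numeral w)) => /= [lt_vw|lt_wv|->].
- by rewrite lt_digits.
- by apply/negbTE; rewrite -leqNgt ltnW ?lt_digits.
- by rewrite ltn_add2l.
Qed.

Lemma numeral_inj (X : finType) (v w : seq X) :
  size v = size w -> numeral v = numeral w -> v = w.
Proof.
elim: v w => [|x v IHv] [|y w] //= [eq_size] eq_num.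
have := numeral_lt x y v w; have := numeral_lt y x w v.
rewrite /= eq_num ltnn; case: ltngtP => //= eq_vw.
rewrite (IHv w) // => nlt_yx nlt_xy; congr (_ :: _).
apply/enum_rank_inj/ord_inj; move: nlt_yx nlt_xy.
by case: ltngtP.
Qed.

(** The list s tells from which place of a each letter of b is copied. If c precedes a,
    then copying the letters of c instead gives a word that precedes b: the most
    significant difference of the two results is at the kept copy of the most
    significant place where c and a differ, as duplicates are less significant
    than the letters that they copy. *)
Lemma folds_substitution (X : finType) (a b : seq X) : folds a b ->
  exists s : seq nat, [/\ size s = size b, all (gtn (size a)) s,
    forall x0, map (nth x0 a) s = b &
    forall x0 (c : seq X), size c = size a -> numeral c < numeral a ->
      numeral (map (nth x0 c) s) < numeral b].
Proof.
elim=> {a b} [|x a b _ [s [size_s s_lt sab s_mono]]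
             |x a b _ [s [size_s s_lt sab s_mono]] xa].
- by exists [::].
- exists (0 :: map succn s); split.
  + by rewrite /= size_map size_s.
  + by rewrite /= all_map.
  + by move=> x0; rewrite /= -map_comp sab.
  + move=> x0 [//|y c] [size_c]; rewrite numeral_lt => lt_ca.
    rewrite [map _ _]/= -map_comp numeral_lt.
    case/orP: lt_ca => [lt_ca|/andP[/eqP eq_ca lt_yx]].
      by rewrite (s_mono x0 c).
    by rewrite (numeral_inj size_c eq_ca) sab eqxx lt_yx orbT.
- exists (index x a :: s); split.
  + by rewrite /= size_s.
  + by rewrite /= index_mem xa.
  + by move=> x0; rewrite /= nth_index // sab.
  + move=> x0 c size_c lt_ca.
    by rewrite [map _ _]/= numeral_lt (s_mono x0 c).
Qed.

(** * Forks and edge operations *)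

(** The argument lists for which the identities of an edge operation say something:
    they treat the first three places specially and the others alike. *)
Definition slots (D : Type) (k : nat) (a b c : D) (w : nat -> D)
    (j : 'I_k.+1) : D :=
  match nat_of_ord j with 0 => a | 1 => b | 2 => c | l.+3 => w l end.

Lemma edge_slots01 (D : Type) (k : nat) (op : ('I_k.+1 -> D) -> D)
    (op_edge : edge_operation op) (x y : D) (w : nat -> D) :
  (forall l, l.+2 < k -> w l = x) -> op (slots y y x w) = x.
Proof.
move=> wx; have [eqx _ _] := op_edge x y; rewrite -[RHS]eqx; congr op.
by apply/funext => -[[|[|[|l]]] lt_lk] //; apply: wx.
Qed.

Lemma edge_slots02 (D : Type) (k : nat) (op : ('I_k.+1 -> D) -> D)
    (op_edge : edge_operation op) (x y : D) (w : nat -> D) :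
  (forall l, l.+2 < k -> w l = x) -> op (slots y x y w) = x.
Proof.
move=> wx; have [_ eqx _] := op_edge x y; rewrite -[RHS]eqx; congr op.
by apply/funext => -[[|[|[|l]]] lt_lk] //; apply: wx.
Qed.

Lemma edge_slots_later (D : Type) (k : nat) (op : ('I_k.+1 -> D) -> D)
    (op_edge : edge_operation op) (x : D) (w : nat -> D) (m : nat) :
  m.+2 < k -> (forall l, l.+2 < k -> l != m -> w l = x) ->
  op (slots x x x w) = x.
Proof.
move=> lt_mk wx; have [_ _ eqx] := op_edge x (w m).
have lt_m3 : m.+3 < k.+1 by [].
rewrite -[RHS](eqx (Ordinal lt_m3)) //; congr op.
apply/funext => -[[|[|[|l]]] lt_lk] //; rewrite /slots -val_eqE /= !eqSS.
by case: eqP => [->//|/eqP neq_lm]; apply: wx.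
Qed.

Lemma slots_apply (I D : Type) (k : nat) (f g h : I -> D)
    (w : nat -> I -> D) (x : I) :
  (fun j : 'I_k.+1 => slots f g h w j x) =
  slots (f x) (g x) (h x) (fun l => w l x).
Proof. by apply/funext => -[[|[|[|l]]] lt_lk]. Qed.

Definition fork (I D : Type) (r : I -> nat) (F : set (I -> D)) (i : I)
    (ab : D * D) : Prop :=
  exists u v, [/\ F u, F v, u i = ab.1, v i = ab.2 &
                  forall j, r j < r i -> u j = v j].

Definition closed_under (I D : Type) (k : nat) (op : ('I_k.+1 -> D) -> D)
    (F : set (I -> D)) : Prop :=
  forall fs : 'I_k.+1 -> I -> D, (forall j, F (fs j)) ->
    F (fun x => op (fun j => fs j x)).

Lemma closed_slots (I D : Type) (k : nat) (op : ('I_k.+1 -> D) -> D)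
    (F : set (I -> D)) (F_closed : closed_under op F)
    (f g h : I -> D) (w : nat -> I -> D) :
  F f -> F g -> F h -> (forall l, F (w l)) ->
  F (fun x => op (slots (f x) (g x) (h x) (fun l => w l x))).
Proof.
move=> Ff Fg Fh Fw.
have -> : (fun x => op (slots (f x) (g x) (h x) (fun l => w l x))) =
          (fun x => op (fun j => slots f g h w j x)).
  by apply/funext => x; rewrite slots_apply.
by apply: F_closed => -[[|[|[|l]]] lt_lk]; rewrite /slots /=.
Qed.

(** Here i is the last point of T. The function f0 agrees with g before i and has some
    value a at i, which has to be corrected to b = g i. Let u, v witness the fork
    (a, b). The edge term t gives p(x, y, z) = t(y, x, z, x, ..., x) with
    p(x, y, y) = x and p(x, x, z) = t(x, x, z, x, ..., x). Write c for
    t(b, b, a, b, ..., b).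
    - For functions w_j that agree with g on T except at k - 1 different points
      c_j, the function f1 = t(w_0, w_0, f0, w_1, ...) agrees with g on T except
      at i, where its value is c: at c_0 only the first two arguments differ
      from g, and at any other c_j only the argument w_j does.
    - For any h in F with value b at i, the functions h and p(h, v, u) agree before
      i and have the values b and c at i.
    Take h equal to g at i and at the points c_j with j > 0. Then
    t(p(h, v, u), f1, h, w_1, ...) agrees with g on T: at i it is
    t(c, c, b, ..., b) = b, at the points c_j with j > 0 all arguments but one are
    equal to g, and elsewhere it is t(h, g, h, g, ..., g) = g. *)
Lemma fork_extension (I : finType) (D : Type) (r : I -> nat) (k : nat)
    (op : ('I_k.+1 -> D) -> D) (F : set (I -> D)) (g : I -> D)
    (i : I) (T : {set I}) :
  1 < k -> edge_operation op -> closed_under op F ->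
  (forall T' : {set I}, #|T'| < k ->
     exists2 f, F f & forall j, j \in T' -> f j = g j) ->
  k <= #|T| -> i \in T -> (forall j, j \in T -> j != i -> r j < r i) ->
  (forall c, c \in T ->
     exists2 f, F f & forall j, j \in T -> j != c -> f j = g j) ->
  (exists2 f, F f & (forall j, r j < r i -> f j = g j) /\
     fork r F i (f i, g i)) ->
  exists2 f, F f & forall j, j \in T -> f j = g j.
Proof.
move=> gt1k op_edge F_closed small le_kT Ti lt_Ti omit.
case=> f0 Ff0 [f0g [u [v [Fu Fv ui vi uv]]]].
have [c0 [cs [uniq_cs size_cs cs_T]]] : exists c0 cs,
    [/\ uniq (c0 :: cs), size cs = k - 2 &
        forall c, c \in c0 :: cs -> c \in T /\ c != i].
  pose s := enum (T :\ i).
  have le_ks : k.-1 <= size s.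
    by rewrite -cardE -ltnS prednK ?(ltnW gt1k) // (leq_trans le_kT) // (cardsD1 i) Ti.
  have size_s : size (take k.-1 s) = k.-1 by rewrite size_takel.
  have uniq_s : uniq (take k.-1 s) by rewrite take_uniq ?enum_uniq.
  have s_T c : c \in take k.-1 s -> c \in T /\ c != i.
    by move/mem_take; rewrite mem_enum !inE => /andP[].
  case: (take k.-1 s) size_s uniq_s s_T => [|c0 cs] /= size_s uniq_s s_T.
    by move: gt1k; case: (k) size_s => [|[]].
  by exists c0, cs; split=> //; rewrite subn2 -size_s.
have /choice[w wP] : forall c, exists f, F f /\
    (c \in T -> forall j, j \in T -> j != c -> f j = g j).
  move=> c; have [Tc|] := boolP (c \in T); last by exists f0.
  by have [f Ff fg] := omit c Tc; exists f.
have Fw c : F (w c) by have [] := wP c.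
have wg c j : c \in c0 :: cs -> j \in T -> j != c -> w c j = g j.
  by move=> /cs_T[Tc _]; have [_] := wP c; apply.
pose wcs l := w (nth c0 cs l).
have nth_cs l : l.+2 < k -> nth c0 cs l \in cs.
  by move=> lt_lk; rewrite mem_nth // size_cs ltn_subRL.
have wcs_out j : j \in T -> j \notin cs ->
    forall l, l.+2 < k -> wcs l j = g j.
  move=> Tj ncs_j l lt_lk; apply: wg => //; first by rewrite inE nth_cs ?orbT.
  by apply: contraNneq ncs_j => ->; apply: nth_cs.
have wcs_in j : j \in T -> j \in cs -> exists2 m, m.+2 < k &
    forall l, l.+2 < k -> l != m -> wcs l j = g j.
  move=> Tj cs_j; exists (index j cs) => [|l lt_lk neq_lm].
    by have := cs_j; rewrite -index_mem size_cs ltn_subRL.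
  apply: wg => //; first by rewrite inE nth_cs ?orbT.
  apply: contra_neq neq_lm => ->; rewrite index_uniq //.
    by rewrite size_cs ltn_subRL.
  by case/andP: uniq_cs.
have [h Fh hg] : exists2 h, F h & forall j, j \in i :: cs -> h j = g j.
  have [|h Fh hg] := small [set j in i :: cs].
    rewrite cardsE (leq_ltn_trans (card_size _)) //= size_cs.
    by case: (k) gt1k => [|[|k']] //=; rewrite subn2.
  by exists h => // j ij; apply: hg; rewrite inE.
pose f1 j := op (slots (w c0 j) (w c0 j) (f0 j) (fun l => wcs l j)).
pose p j := op (slots (v j) (h j) (u j) (fun=> h j)).
have Fwcs l : F (wcs l) by apply: Fw.
have Ff1 : F f1 := closed_slots F_closed (Fw c0) (Fw c0) Ff0 Fwcs.
have Fp : F p := closed_slots F_closed Fv Fh Fu (fun=> Fh).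
exists (fun j => op (slots (p j) (f1 j) (h j) (fun l => wcs l j))).
  exact: (closed_slots F_closed Fp Ff1 Fh Fwcs).
move=> j Tj; have [-> {j Tj}|neq_ji] := eqVneq j i.
  have ncs_i : i \notin cs.
    by apply/negP => cs_i; have [] := cs_T i; rewrite ?inE ?cs_i ?orbT ?eqxx.
  have wi := wcs_out i Ti ncs_i.
  have w0i : w c0 i = g i.
    by apply: wg; rewrite ?mem_head // eq_sym; have [] := cs_T c0 (mem_head _ _).
  have hi : h i = g i by rewrite hg ?mem_head.
  have -> : p i = f1 i.
    rewrite /p /f1 vi ui hi w0i /=; congr op.
    apply/funext => -[[|[|[|l]]] lt_lk] //; rewrite /slots /=.
    by rewrite wi.
  by rewrite hi; apply: edge_slots01.
have lt_ji := lt_Ti j Tj neq_ji.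
have -> : p j = h j by rewrite /p -uv //; apply: edge_slots02.
have -> : f1 j = g j.
  rewrite /f1 f0g //; have [->|neq_j0] := eqVneq j c0.
    apply: edge_slots01 => //; apply: wcs_out.
      by have [] := cs_T c0 (mem_head _ _).
    by case/andP: uniq_cs.
  rewrite wg ?mem_head //.
  have [cs_j|ncs_j] := boolP (j \in cs); last exact/edge_slots01/wcs_out.
  by have [m lt_mk] := wcs_in j Tj cs_j; apply: edge_slots_later.
have [cs_j|ncs_j] := boolP (j \in cs); last exact/edge_slots02/wcs_out.
rewrite hg ?inE ?cs_j ?orbT //.
by have [m lt_mk] := wcs_in j Tj cs_j; apply: edge_slots_later.
Qed.

(** Every g in G agrees with some member of F on each finite set T of points, by
    induction on the position of the last point of T and then on the size of T. *)
Lemma eq_of_forks (I : finType) (D : Type) (r : I -> nat) (k : nat)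
    (op : ('I_k.+1 -> D) -> D) (F G : set (I -> D)) :
  injective r -> 1 < k -> edge_operation op -> closed_under op F ->
  (forall f, F f -> G f) ->
  (forall (T : {set I}) g, #|T| < k -> G g ->
     exists2 f, F f & forall j, j \in T -> f j = g j) ->
  (forall i ab, fork r G i ab -> fork r F i ab) ->
  forall g, G g -> F g.
Proof.
move=> r_inj gt1k op_edge F_closed FG small forks g Gg.
suff agree n : forall T : {set I}, (forall j, j \in T -> r j < n) ->
    exists2 f, F f & forall j, j \in T -> f j = g j.
  have [j _|f Ff fg] := agree (\max_j r j).+1 [set: I].
    exact: (leq_bigmax (F := r)).
  by rewrite (_ : g = f) //; apply/funext => j; rewrite fg.
elim: n => [|n IHn] T lt_Tn.
  apply: small => //; suff -> : T = finset.set0 by rewrite cards0 (ltnW gt1k).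
  by apply/setP => j; rewrite inE; apply/negP => /lt_Tn.
have [m] := ubnP #|T|; elim: m => // m IHm in T lt_Tn *; rewrite ltnS => le_Tm.
have [lt_Tk|le_kT] := ltnP #|T| k; first exact: small.
have [/existsP[i /andP[Ti /eqP ri]]|noi] := boolP [exists i in T, r i == n]; last first.
  apply: IHn => j Tj; have := lt_Tn j Tj; rewrite ltnS leq_eqVlt.
  by case/predU1P => // rj; case/existsP: noi; exists j; rewrite Tj rj eqxx.
apply: (@fork_extension I D r k op F g i T) => //.
- by move=> T' lt_T'; apply: small.
- move=> j Tj neq_ji; have := lt_Tn j Tj; rewrite ltnS leq_eqVlt ri.
  by case/predU1P => // rj; case/eqP: neq_ji; apply: r_inj; rewrite ri.
- move=> c Tc; have [||f Ff fg] := IHm (T :\ c).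
  + by move=> j; rewrite inE => /andP[_ /lt_Tn].
  + by rewrite (leq_trans _ le_Tm) // (cardsD1 c T) Tc.
  + by exists f => // j Tj neq_jc; apply: fg; rewrite !inE neq_jc.
have [|f Ff fg] := IHn [set j | r j < n]; first by move=> j; rewrite inE.
have {}fg j : r j < r i -> f j = g j by rewrite ri => lt_jn; apply: fg; rewrite inE.
exists f => //; split=> //; apply: forks; exists f, g; split=> //; exact: FG.
Qed.

(** * Families closed under renaming of variables *)

Definition relabel (X : Type) (n m : nat) (h : 'I_n -> 'I_m) (x : m.-tuple X) :
    n.-tuple X :=
  [tuple tnth x (h i) | i < n].

Lemma relabel_id (X : Type) (n : nat) (x : n.-tuple X) : relabel id x = x.
Proof. by apply: eq_from_tnth => i; rewrite tnth_mktuple. Qed.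

Lemma relabel_comp (X : Type) (n m l : nat) (h : 'I_n -> 'I_m)
    (h' : 'I_m -> 'I_l) (x : l.-tuple X) :
  relabel h (relabel h' x) = relabel (h' \o h) x.
Proof. by apply: eq_from_tnth => i; rewrite !tnth_mktuple. Qed.

(** The functions h need not be injective, so variables may be identified. *)
Definition closed_under_renaming (X D : Type)
    (R : forall n, set (n.-tuple X -> D)) : Prop :=
  forall n m (h : 'I_n -> 'I_m) u, R n u -> R m (u \o relabel h).

(** The points of T have at most #|X| ^ #|T| different columns. Identifying variables
    with equal columns does not change the values of u on T and brings the arity
    down to at most N, where R' is contained in R. *)
Lemma small_projections (X : finType) (D : Type)
    (R R' : forall n, set (n.-tuple X -> D)) (k N n : nat)
    (T : {set n.-tuple X}) (u : n.-tuple X -> D) :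
  closed_under_renaming R -> closed_under_renaming R' ->
  #|X|.+1 ^ k <= N -> (forall m v, m <= N -> R' m v -> R m v) ->
  #|T| < k -> R' n u ->
  exists2 v, R n v & forall x, x \in T -> v x = u x.
Proof.
move=> R_ren R'_ren le_XkN R'R lt_Tk R'u.
have [le_nN|lt_Nn] := leqP n N; first by exists u => //; apply: R'R.
have i0 : 'I_n := Ordinal (leq_trans (ltn0Sn N) lt_Nn).
pose column (i : 'I_n) := [ffun j : 'I_#|T| => tnth (enum_val j) i].
pose M := #|{: {ffun 'I_#|T| -> X}}|.
have le_MN : M <= N.
  rewrite /M card_ffun card_ord (leq_trans _ le_XkN) //.
  apply: (@leq_trans (#|X|.+1 ^ #|T|)); last by rewrite leq_pexp2l // ltnW.
  by case: #|T| => // l; rewrite leq_exp2r.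
pose s i : 'I_M := enum_rank (column i).
pose s' (j : 'I_M) := odflt i0 [pick i | s i == j].
have ss' i : column (s' (s i)) = column i.
  apply: enum_rank_inj; rewrite /s'; case: pickP => [i' /eqP //|/(_ i)].
  by rewrite eqxx.
exists ((u \o relabel s) \o relabel s').
  by apply: R_ren; apply: R'R => //; apply: R'_ren.
move=> x Tx; rewrite /= relabel_comp; congr u.
apply: eq_from_tnth => i; rewrite tnth_mktuple /=.
by have /ffunP/(_ (enum_rank_in Tx x)) := ss' i; rewrite !ffunE enum_rankK_in.
Qed.

(** The linear order on points that is used for forks. *)
Definition position (X : finType) (n : nat) (x : n.-tuple X) : nat := numeral x.

Lemma position_inj (X : finType) (n : nat) : injective (@position X n).
Proof.
by move=> x y eq_xy; apply/val_inj/numeral_inj; rewrite ?size_tuple.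
Qed.

Lemma fork_folds (X : finType) (D : Type)
    (R : forall n, set (n.-tuple X -> D)) (a b : seq X) (pq : D * D) :
  closed_under_renaming R -> folds a b ->
  fork (@position X _) (R (size b)) (in_tuple b) pq ->
  fork (@position X _) (R (size a)) (in_tuple a) pq.
Proof.
move=> R_ren /folds_substitution[s [size_s s_lt sab s_mono]].
have h_lt (i : 'I_(size b)) : nth 0 s i < size a.
  by apply: (allP s_lt); rewrite mem_nth // size_s.
pose h i := Ordinal (h_lt i).
have hE x0 (c : (size a).-tuple X) : tval (relabel h c) = map (nth x0 c) s.
  apply: (@eq_from_nth _ x0); rewrite size_tuple ?size_map // => i lt_ib.
  rewrite (nth_map 0) ?size_s // -(tnth_nth _ _ (Ordinal lt_ib)).
  by rewrite tnth_mktuple (tnth_nth x0).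
have hab : relabel h (in_tuple a) = in_tuple b.
  apply: eq_from_tnth => i; pose x0 := tnth (in_tuple b) i.
  by rewrite !(tnth_nth x0) (hE x0) sab.
case=> u [v [Ru Rv ua va uv]].
exists (u \o relabel h), (v \o relabel h); split; try exact: R_ren.
- by rewrite /= hab.
- by rewrite /= hab.
- move=> c lt_ca /=; apply: uv.
  have [x0 _] : exists x0, x0 \in a.
    move: lt_ca; rewrite /position /=; move: (numeral c) => q.
    by case: (a) => [|x0 a'] // _; exists x0; apply: mem_head.
  by rewrite /position (hE x0) s_mono ?size_tuple.
Qed.

(** The hypothesis on u defines the largest family closed under renaming that
    coincides with R up to arity N; for suitable N it has the same forks and the same
    small projections as R. *)
Lemma determined_by_small_arity (X D : finType) (k : nat)
    (op : ('I_k.+1 -> D) -> D) (R : forall n, set (n.-tuple X -> D)) :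
  1 < k -> edge_operation op -> (forall n, closed_under op (R n)) ->
  closed_under_renaming R ->
  exists N, forall n u,
    (forall m (h : 'I_n -> 'I_m), m <= N -> R m (u \o relabel h)) -> R n u.
Proof.
move=> gt1k op_edge R_closed R_ren.
pose forks (P : forall n, set (n.-tuple X -> D)) (w : seq X) : {set D * D} :=
  [set pq | `[< fork (@position X _) (P (size w)) (in_tuple w) pq >]].
have [N1 basis] := folds_basis (forks R).
pose N := maxn N1 (#|X|.+1 ^ k).
exists N.
pose R' n : set (n.-tuple X -> D) := fun u =>
  forall m (h : 'I_n -> 'I_m), m <= N -> R m (u \o relabel h).
have R'_ren : closed_under_renaming R'.
  move=> n m h u R'u l h' le_lN.
  have := R'u l (h' \o h) le_lN.
  by congr (R l _); apply/funext => x /=; rewrite relabel_comp.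
have RR' n u : R n u -> R' n u by move=> Ru m h _; apply: R_ren.
have R'R m v : m <= N -> R' m v -> R m v.
  move=> le_mN /(_ m id le_mN).
  by congr (R m _); apply/funext => x /=; rewrite relabel_id.
have forks_le w pq : fork (@position X _) (R' (size w)) (in_tuple w) pq ->
    fork (@position X _) (R (size w)) (in_tuple w) pq.
  have [a [le_aN fold_aw eq_forks]] := basis w.
  move/(fork_folds R'_ren fold_aw) => [u [v [R'u R'v ua va uv]]].
  have : pq \in forks R a.
    rewrite inE; apply/asboolP; exists u, v; split=> //; apply: R'R => //.
      by rewrite (leq_trans le_aN) ?leq_maxl.
    by rewrite (leq_trans le_aN) ?leq_maxl.
  by rewrite eq_forks inE => /asboolP.
move=> n; apply: (@eq_of_forks _ _ (@position X n) k op (R n) (R' n)) => //.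
- exact: position_inj.
- exact: R_closed.
- exact: RR'.
- move=> T g lt_Tk R'g; 
  exact: (small_projections R_ren R'_ren (leq_maxr _ _) R'R lt_Tk R'g).
- case=> w eq_wn pq; have eqn := eqP eq_wn; subst n.
  have -> : Tuple eq_wn = in_tuple w by apply: val_inj.
  exact: forks_le.
Qed.

(** * Identities of subvarieties *)

Fixpoint subst (S : signature) (X Y : Type) (s : term S X) (g : X -> term S Y) :
    term S Y :=
  match s with
  | Var x => g x
  | App f ss => App (fun i => subst (ss i) g)
  end.

Lemma eval_subst (S : signature) (X Y : Type) (A : algebra S) (s : term S X)
    (g : X -> term S Y) (v : Y -> A) :
  eval A (subst s g) v = eval A s (fun x => eval A (g x) v).
Proof. by elim: s => //= f ss IH; congr interp; apply/funext => i. Qed.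

Definition rename (S : signature) (X Y : Type) (h : X -> Y) (s : term S X) :
    term S Y :=
  subst s (fun x => Var S (h x)).

Lemma eval_rename (S : signature) (X Y : Type) (A : algebra S) (s : term S X)
    (h : X -> Y) (v : Y -> A) :
  eval A (rename h s) v = eval A s (v \o h).
Proof. exact: eval_subst. Qed.

(** A term contains finitely many variables although symbols and their arities are
    unrestricted, because each arity is finite. *)
Lemma eval_finite_support (S : signature) (s : term S nat) :
  exists N, forall n, N <= n -> forall (A : algebra S) (v : nat -> A),
    eval A (rename (@inord n) s) (v \o val) = eval A s v.
Proof.
elim: s => [x|f ss IH].
  by exists x => n le_xn A v; rewrite eval_rename /= inordK.
have [N NP] := choice IH.
exists (\max_i N i) => n le_Nn A v; rewrite /= -/(rename _ _).
congr interp; apply/funext => i; apply: NP; apply: leq_trans le_Nn.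
exact: leq_bigmax.
Qed.

Lemma finite_type_ordinal (A : Type) : finite_set [set: A]%classic ->
  exists q (enc : A -> 'I_q), bijective enc.
Proof.
case/finite_setP => q; rewrite (card_eqr card_II) => /card_bijP[f [g fK gK]].
exists q, (val \o f \o to_setT), (val \o g \o to_setT) => [a|i] /=.
  have -> : to_setT (val (f (to_setT a))) = f (to_setT a) by apply: val_inj.
  by rewrite fK.
have -> : to_setT (val (g (to_setT i))) = g (to_setT i) by apply: val_inj.
by rewrite gK.
Qed.

(** The carrier of A is replaced by an ordinal, through the inverse bijections enc and
    dec, to have finite types of words and of operations. *)
Definition term_operation (S : signature) (A : algebra S) (q : nat)
    (enc : A -> 'I_q) (dec : 'I_q -> A) (n : nat) (s : term S 'I_n)
    (x : n.-tuple 'I_q) : 'I_q :=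
  enc (eval A s (dec \o tnth x)).

Definition equated (S : signature) (A : algebra S) (q : nat)
    (enc : A -> 'I_q) (dec : 'I_q -> A) (W : set (algebra S)) (n : nat) :
    set (n.-tuple 'I_q -> 'I_q * 'I_q) :=
  fun u => exists s t : term S 'I_n,
    (forall B : algebra S, W B -> forall v, eval B s v = eval B t v) /\
    u = (fun x => (term_operation enc dec s x, term_operation enc dec t x)).

Lemma equated_renaming (S : signature) (A : algebra S) (q : nat)
    (enc : A -> 'I_q) (dec : 'I_q -> A) (W : set (algebra S)) :
  closed_under_renaming (equated enc dec W).
Proof.
move=> n m h _ [s [t [eq_st ->]]]; exists (rename h s), (rename h t); split.
  by move=> B WB v; rewrite !eval_rename eq_st.
have dec_relabel x : dec \o tnth (relabel h x) = (dec \o tnth x) \o h.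
  by apply/funext => i; rewrite /= tnth_mktuple.
by apply/funext => x; rewrite /term_operation /= !eval_rename dec_relabel.
Qed.

(** The term operation of e on the square of A, transported along enc. *)
Definition pair_operation (S : signature) (A : algebra S) (q k : nat)
    (enc : A -> 'I_q) (dec : 'I_q -> A) (e : term S 'I_k)
    (d : 'I_k -> 'I_q * 'I_q) : 'I_q * 'I_q :=
  (enc (eval A e (fun j => dec (d j).1)), enc (eval A e (fun j => dec (d j).2))).

Lemma equated_closed (S : signature) (A : algebra S) (q k : nat)
    (enc : A -> 'I_q) (dec : 'I_q -> A) (e : term S 'I_k.+1)
    (W : set (algebra S)) (n : nat) : cancel enc dec ->
  closed_under (pair_operation enc dec e) (equated enc dec W (n:=n)).
Proof.
move=> encK us /choice[s /choice[t eq_st]].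
exists (subst e s), (subst e t); split.
  move=> B WB v; rewrite !eval_subst; congr eval; apply/funext => j.
  by have [->] := eq_st j.
apply/funext => x; rewrite /pair_operation /term_operation !eval_subst.
by congr (enc (eval A e _), enc (eval A e _)); apply/funext => j;
  have [_ ->] := eq_st j; rewrite /= encK.
Qed.

Lemma pair_operation_edge (S : signature) (A : algebra S) (q k : nat)
    (enc : A -> 'I_q) (dec : 'I_q -> A) (e : term S 'I_k.+1) :
  cancel dec enc -> edge_operation (eval A e) ->
  edge_operation (pair_operation enc dec e).
Proof.
move=> decK e_edge x y.
have ifE (P : pred 'I_k.+1) :
    pair_operation enc dec e (fun j => if P j then y else x) =
    (enc (eval A e (fun j => if P j then dec y.1 else dec x.1)),
     enc (eval A e (fun j => if P j then dec y.2 else dec x.2))).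
  by congr (enc (eval A e _), enc (eval A e _)); apply/funext => j; case: (P j).
have [e11 e12 e13] := e_edge (dec x.1) (dec y.1).
have [e21 e22 e23] := e_edge (dec x.2) (dec y.2).
split; first by rewrite ifE e11 e21 !decK -surjective_pairing.
  by rewrite ifE e12 e22 !decK -surjective_pairing.
move=> i le3i; rewrite (ifE (fun j => j == i)).
by rewrite e13 // e23 // !decK -surjective_pairing.
Qed.

(** An identity s = t of W' gives an equated pair of operations of A. If W equates the
    same pair, it satisfies some identity s2 = t2 with the same pair of operations,
    and W satisfies s = s2 and t = t2 because A does. *)
Lemma sub_of_equated (S : signature) (A : algebra S) (q : nat)
    (enc : A -> 'I_q) (dec : 'I_q -> A) (W W' : set (algebra S)) :
  cancel enc dec -> variety W' -> subset W (variety_of A) ->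
  (forall n u, equated enc dec W' (n:=n) u -> equated enc dec W u) ->
  subset W W'.
Proof.
move=> encK [E' ->] WA W'W B WB [s t] E'st v /=.
have [N1 sE] := eval_finite_support s; have [N2 tE] := eval_finite_support t.
pose n := maxn N1 N2.
rewrite -(sE n (leq_maxl _ _)) -(tE n (leq_maxr _ _)); move: (v \o val) => {}v.
set s' := rename _ s; set t' := rename _ t.
have [s2 [t2 [eq_st2 eq_ops]]] : equated enc dec W (n:=n.+1)
    (fun x => (term_operation enc dec s' x, term_operation enc dec t' x)).
  apply: W'W; exists s', t'; split=> // C C_E w; rewrite !eval_rename.
  exact: (C_E (s, t) E'st).
(* Since W lies in the variety of A, terms with the same values in A have the
   same values in B. *)
have transfer (p p2 : term S 'I_n.+1) :
    term_operation enc dec p = term_operation enc dec p2 ->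
    eval B p v = eval B p2 v.
  move=> eq_p.
  have /(WA B WB)/(_ (v \o @inord n)) :
      identities A (rename val p, rename val p2).
    move=> w /=; rewrite !eval_rename.
    have := congr1 dec (congr1 (@^~ [tuple enc (w (val i)) | i < n.+1]) eq_p).
    rewrite /term_operation !encK.
    suff -> : dec \o tnth [tuple enc (w (val i)) | i < n.+1] = w \o val by [].
    by apply/funext => i; rewrite /= tnth_mktuple encK.
  rewrite /= !eval_rename.
  suff -> : (v \o @inord n) \o val = v by [].
  by apply/funext => i; rewrite /= inord_val.
have ops x := congr1 (@^~ x) eq_ops.
rewrite (transfer s' s2) ?(transfer t' t2) ?eq_st2 //.
  by apply/funext => x; case: (ops x).
by apply/funext => x; case: (ops x).
Qed.

Theorem corollary1p3 (S : signature) (V : set (algebra S))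
  (V_variety : variety V) (V_fin_gen : finitely_generated V)
  (V_edge : has_edge_term V) :
  countable (subvarieties V).
Proof.
have [A /finite_type_ordinal[q [enc [dec encK decK]]] defV] := V_fin_gen.
have [k gt1k [e e_edge]] := V_edge.
have A_edge : edge_operation (eval A e) by apply: e_edge; rewrite defV.
pose R W n := equated enc dec W (n:=n).
have /choice[N NP] : forall W, exists N, forall n u,
    (forall m (h : 'I_n -> 'I_m), m <= N -> R W m (u \o relabel h)) -> R W n u.
  move=> W; apply: (determined_by_small_arity gt1k
                      (pair_operation_edge decK A_edge)).
    by move=> n; apply: equated_closed.
  exact: equated_renaming.
(* [code W] lists the sets of equated pairs in the arities up to N W; its length
   records N W. *)
pose level W n : {set {ffun n.-tuple 'I_q -> 'I_q * 'I_q}} :=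
  [set u : {ffun _} | `[< R W n u >]].
have levelP W W' n u : level W n = level W' n -> R W n u -> R W' n u.
  move/setP/(_ (finfun u)); rewrite !inE.
  have -> : finfun u = u :> (_ -> _) by apply/funext => x; rewrite ffunE.
  by move=> eq_R Ru; apply/asboolP; rewrite -eq_R; apply/asboolP.
pose code W := [seq Tagged (fun n => {set {ffun n.-tuple 'I_q -> 'I_q * 'I_q}})
                           (level W n) | n <- iota 0 (N W).+1].
have code_le W W' : code W = code W' -> forall n u, R W n u -> R W' n u.
  move=> eq_code.
  have eq_N : N W = N W'.
    by have := congr1 size eq_code; rewrite !size_map !size_iota => -[].
  move=> n u Ru; apply: NP => m h le_mN.
  apply: (levelP W); last exact: equated_renaming.
  have m_iota : m \in iota 0 (N W).+1.
    by rewrite mem_iota ltnS eq_N.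
  have : code W = code W' by []; rewrite /code -eq_N => /eq_in_map/(_ m m_iota).
  by move/eqP; rewrite eq_Tagged => /eqP.
apply/countable_injP; exists (pickle \o code) => W W'.
rewrite !inE => -[W_var WV] [W'_var W'V] /(pcan_inj pickleK) eq_code.
rewrite defV in WV W'V.
apply/seteqP; split.
  apply: (sub_of_equated encK W'_var WV); exact: code_le.
apply: (sub_of_equated encK W_var W'V); exact: code_le.
Qed.
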